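(* For every $\eta \in (0,1)$ there exist $K_1, C_\eta > 0$ and $K_2 \geq e$ depending only on $\eta$ such that, for all integers $n \geq 1$, $p \geq 2$ and all $q_0 \in \Delta_p$ with $q_0(1) \geq q_0(2) \geq \dots \geq q_0(p) \geq 0$, $$P_{q_0}\{\varphi = 1\} + \sup_{q \in \Pi(q_0, C_\eta\varepsilon)} P_q\{\varphi = 0\} \leq \eta,$$ where $\varphi = \varphi_1 \vee \varphi_2$ with $$\varphi_1 = \mathbf{1}\left\{|X_1 - nq_0(1)| \geq K_1\left(1 + \sqrt{nq_0(1)(1-q_0(1))}\right)\right\},$$ $$\varphi_2 = \mathbf{1}\left\{\max_{2 \leq j \leq p}|X_j - nq_0(j)| > \max_{2 \leq j \leq p} nq_0(j)(1-q_0(j))h^{-1}\left(\frac{\log(K_2(j-1)^2)}{nq_0(j)(1-q_0(j))}\right)\right\},$$ and $$\varepsilon = \frac{1}{n} + \sqrt{\frac{q_0^{\max}(1-q_0^{\max})}{n}} + \max_{1 \leq j \leq p-1} q_0^{-\max}(j)(1-q_0^{-\max}(j))h^{-1}\left(\frac{\log(ej)}{nq_0^{-\max}(j)(1-q_0^{-\max}(j))}\right).$$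
   Context: $\Delta_p = \{\pi \in [0,1]^p : \sum_{j=1}^p \pi(j) = 1\}$. For $q \in \Delta_p$, $P_q$ denotes the law of $X = (X_1,\dots,X_p) \sim \mathrm{Multinomial}(n,q)$. For $\varepsilon > 0$, $\Pi(q_0,\varepsilon) = \{q \in \Delta_p : \|q - q_0\|_\infty \geq \varepsilon\}$ with $\|v\|_\infty = \max_j|v_j|$; a supremum over the empty set is $0$. Write $q_0^{\max} = \max_j q_0(j) = q_0(1)$ and $q_0^{-\max} = (q_0(2),\dots,q_0(p)) \in [0,1]^{p-1}$, so $q_0^{-\max}(j) = q_0(j+1)$. The function $h : [-1,\infty) \to \mathbb{R}$ is defined by $h(-1) = 1$ and $h(x) = (1+x)\log(1+x) - x$ for $x > -1$; $h^{-1} : [0,\infty) \to [0,\infty)$ is the inverse of $h$ restricted to $[0,\infty)$. An expression of the form $x\,h^{-1}(a/x)$ is interpreted as $0$ (its limit) when $x = 0$. *)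

(* Defs.v *)
From mathcomp Require Import all_boot all_order all_algebra.
From mathcomp Require Import boolp classical_sets functions set_interval reals sequences exp.

Set Implicit Arguments.
Unset Strict Implicit.
Unset Printing Implicit Defensive.

Import Order.TTheory GRing.Theory Num.Theory.

Local Open Scope classical_set_scope.
Local Open Scope ring_scope.

(* Coordinates 1, ..., p are represented by 'I_p, hence numbered from 0: the
   mathematical index j is the ordinal of value j - 1. All iterated maxima below
   are over nonnegative quantities, so the default value 0 is harmless. *)

Definition simplex (R : realType) (p : nat) : set ('I_p -> R) :=
  [set q | (forall j, 0 <= q j <= 1) /\ \sum_(j < p) q j = 1].

Definition multinomial_pmf (R : realType) (n p : nat) (q : 'I_p -> R)
    (x : 'I_p -> nat) : R :=
  if (\sum_(j < p) x j == n)%N then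
    n`!%:R / (\prod_(j < p) (x j)`!)%N%:R * \prod_(j < p) q j ^+ x j
  else 0.

(* P_q {X \in A} for X ~ Multinomial(n, q); each count is at most n, so the
   law is carried by the finite type of maps 'I_p -> {0, ..., n}. *)
Definition multinomial_prob (R : realType) (n p : nat) (q : 'I_p -> R)
    (A : pred ('I_p -> nat)) : R :=
  \sum_(x : {ffun 'I_p -> 'I_n.+1} | A (fun j => x j : nat))
    multinomial_pmf n q (fun j => x j : nat).

Definition sup_norm (R : realType) (p : nat) (v : 'I_p -> R) : R :=
  \big[Num.max/0]_(j < p) `|v j|.

Definition alternatives (R : realType) (p : nat) (q0 : 'I_p -> R) (eps : R) :
    set ('I_p -> R) :=
  [set q | simplex q /\ eps <= sup_norm (fun j => q j - q0 j)].

(* Only meaningful on [-1, +oo[. *)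
Definition h (R : realType) (x : R) : R :=
  if x == -1 then 1 else (1 + x) * ln (1 + x) - x.

(* The inverse of h restricted to [0, +oo[, with junk value 0 outside
   h @` [0, +oo[ = [0, +oo[. *)
Definition hinv (R : realType) : R -> R := 'pinv_(fun=> 0) `[0, +oo[ (@h R).

(* v h^-1(a / (n v)), read as 0 when v = 0. *)
Definition vhinv (R : realType) (n : nat) (a v : R) : R :=
  if v == 0 then 0 else v * hinv (a / (n%:R * v)).

Definition ord_first (p : nat) (hp : (2 <= p)%N) : 'I_p := Ordinal (ltnW hp).

Definition phi1 (R : realType) (n p : nat) (hp : (2 <= p)%N) (K1 : R)
    (q0 : 'I_p -> R) (x : 'I_p -> nat) : bool :=
  let i := ord_first hp in
  `|(x i)%:R - n%:R * q0 i| >=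
    K1 * (1 + Num.sqrt (n%:R * q0 i * (1 - q0 i))).

(* The range 0 < j is the mathematical 2 <= j <= p, so that the factor
   (j - 1)^2 of the mathematical index is j ^+ 2 here. *)
Definition phi2 (R : realType) (n p : nat) (K2 : R)
    (q0 : 'I_p -> R) (x : 'I_p -> nat) : bool :=
  \big[Num.max/0]_(j < p | (0 < j)%N) `|(x j)%:R - n%:R * q0 j| >
  \big[Num.max/0]_(j < p | (0 < j)%N)
    (n%:R * vhinv n (ln (K2 * (j : nat)%:R ^+ 2)) (q0 j * (1 - q0 j))).

Definition phi (R : realType) (n p : nat) (hp : (2 <= p)%N) (K1 K2 : R)
    (q0 : 'I_p -> R) (x : 'I_p -> nat) : bool :=
  phi1 n hp K1 q0 x || phi2 n K2 q0 x.

Definition qmax (R : realType) (p : nat) (q0 : 'I_p -> R) : R :=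
  \big[Num.max/0]_(j < p) q0 j.

(* q0^{-max}(j) is the mathematical q0(j + 1), 1 <= j <= p - 1, i.e. q0 at the
   ordinal of value j: the last maximum ranges over the ordinals 0 < j < p. *)
Definition eps_rate (R : realType) (n p : nat) (q0 : 'I_p -> R) : R :=
  n%:R^-1 + Num.sqrt (qmax q0 * (1 - qmax q0) / n%:R) +
  \big[Num.max/0]_(j < p | (0 < j)%N)
    vhinv n (ln (expR 1 * (j : nat)%:R)) (q0 j * (1 - q0 j)).

(* Main.v *)
Require Import Defs.
From mathcomp Require Import all_boot all_order all_algebra.
From mathcomp Require Import boolp classical_sets functions set_interval reals sequences exp.
From mathcomp Require Import topology normedtype realfun.
From mathcomp Require Import ring lra.

(** The test compares each count X_j with its null mean n q0(j), and both of
    its errors reduce to tail bounds for one count.  Coordinates are numbered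
    from 0 here, so that q0(0) is the largest null probability.

    _False alarms._ Chebyshev's inequality makes the first test reject with
    probability at most 1/K1^2 ([chebyshev]).  For the other coordinates put
    V = n q0(j)(1 - q0(j)).  Bennett's inequality ([bennett]) bounds the
    probability that X_j is at least V t away from its mean by
    2 exp(- V h(t)), so the threshold V h^-1(a / V) is exceeded with
    probability at most 2 exp(-a) ([prob_gt_vhinv]).  With a = ln(K2 j^2)
    this is 2 / (K2 j^2), which is summable: the union bound gives 4 / K2.

    _Missed alternatives._ Let q(j) differ from q0(j) by d >= C eps.  Both
    thresholds are at most n (C / 2) eps <= n d / 2.  For the first one this
    is the choice of C.  For the second one,
    ln(K2 j^2) <= (2 + ln K2) ln(e j), and h^-1 is concave with h^-1(0) = 0,
    so that multiplying its argument by M >= 1 multiplies its value by at most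
    M ([hinv_le_scale]).  An accepted sample hence has X_j at distance at least
    n d / 2 from its true mean n q(j), which Chebyshev's inequality makes
    unlikely ([prob_far_le]).  The variance it involves is controlled by the
    null variance of the first coordinate, which is in eps: the map
    x |-> x(1 - x) is 1-Lipschitz on [0, 1] ([variance_lipschitz]), and since
    q0(j) is at most both q0(0) and 1 - q0(0) for j > 0, no null variance
    exceeds the first one ([variance_le_first]).

    Both tail bounds come from the probability generating function of a single
    count, which the multinomial theorem evaluates ([count_pgfE]): its
    derivatives at 1 give the variance, its values at exp(l) and exp(-l) the
    exponential moments. *)

Set Implicit Arguments.
Unset Strict Implicit.
Unset Printing Implicit Defensive.

Import Order.TTheory GRing.Theory Num.Theory.
Import numFieldNormedType.Exports.

Local Open Scope classical_set_scope.
Local Open Scope ring_scope.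

(** * Moments of the counts *)

(** The truncated exponential series E(b) = \sum_(k <= n) b^k X^k / k!
    multiply like exponentials up to degree n, and the coefficient of X^n in
    \prod_j E(a_j), read off in two ways, is the identity divided by n!.
    An algebra A in place of R lets the a_j be polynomials. *)
Lemma multinomial_theorem (R : numFieldType) (A : comAlgType R) n p
    (a : 'I_p -> A) :
  \sum_(x : {ffun 'I_p -> 'I_n.+1} | (\sum_j x j == n)%N)
     (n`!%:R / (\prod_j (x j)`!)%N%:R) *: \prod_j a j ^+ x j
  = (\sum_j a j) ^+ n.
Proof.
have fact0 k : k`!%:R != 0 :> R by rewrite pnatr_eq0 -lt0n fact_gt0.
pose E (b : A) : {poly A} := \poly_(k < n.+1) (k`!%:R^-1 *: b ^+ k).
have coefE i : (i <= n)%N ->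
    (\prod_j E (a j))`_i = i`!%:R^-1 *: (\sum_j a j) ^+ i.
  elim/big_rec2: _ i => [|j P s _ IH] i le_in.
    rewrite coef1 expr0n; case: i {le_in} => [|i]; rewrite ?scaler0//.
    by rewrite invr1 scale1r.
  rewrite coefM [_ + _]addrC exprDn scaler_sumr; apply: eq_bigr => -[k ltk] _ /=.
  have le_ki : (k <= i)%N by [].
  rewrite coef_poly (leq_ltn_trans le_ki) ?ltnS// IH ?(leq_trans (leq_subr _ _))//.
  rewrite -scalerAl -scalerAr scalerA -[_ *+ 'C(i, k)](@scaler_nat R) scalerA.
  rewrite [_ * a j ^+ k]mulrC.
  congr (_ *: _); rewrite -(bin_fact le_ki) !natrM.
  have C0 : 'C(i, k)%:R != 0 :> R by rewrite pnatr_eq0 -lt0n bin_gt0.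
  by rewrite !invfM mulrA mulrAC -mulrA; field; rewrite C0 !fact0.
have := coefE n (leqnn n); under eq_bigr do rewrite /E poly_def.
rewrite bigA_distr_bigA coef_sum => /(congr1 (fun y => n`!%:R *: y)).
rewrite scalerA divff// scale1r => <-.
rewrite scaler_sumr [LHS]big_mkcond /=; apply: eq_bigr => x _.
rewrite scaler_prod scaler_prod prodfV -natr_prod prodrXr coefZ coefXn.
by rewrite eq_sym; case: eqP => _; rewrite ?mulr1 ?mulr0 ?scaler0// scalerA.
Qed.

Section Multinomial.
Variables (R : realType) (n p : nat) (q : 'I_p -> R).
Implicit Types (A B : pred ('I_p -> nat)) (j : 'I_p).

Definition expectation (f : ('I_p -> nat) -> R) : R :=
  \sum_(x : {ffun 'I_p -> 'I_n.+1})
    multinomial_pmf n q (fun j => x j : nat) * f (fun j => x j : nat).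

Definition count_pgf j : {poly R} :=
  \sum_(x : {ffun 'I_p -> 'I_n.+1})
    multinomial_pmf n q (fun j => x j : nat) *: 'X^(x j).

Hypothesis q_simplex : simplex q.

Lemma pmf_ge0 x : 0 <= multinomial_pmf n q x.
Proof.
rewrite /multinomial_pmf; case: ifP => // _.
apply: mulr_ge0; first by rewrite divr_ge0 ?ler0n.
by apply: prodr_ge0 => i _; apply: exprn_ge0; case: q_simplex => /(_ i)/andP[].
Qed.

(** Marking the outcomes of category j by the indeterminate, that is, replacing
    its probability by q_j X, turns the multinomial theorem into the generating
    function of a binomial law. *)
Lemma count_pgfE j : count_pgf j = ((1 - q j)%:P + q j *: 'X) ^+ n.
Proof.
have -> : (1 - q j)%:P + q j *: 'X = \sum_i q i *: 'X^(i == j) :> {poly R}.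
  case: q_simplex => _ <-; rewrite (bigD1 j)//= [q j + _]addrC addrK addrC.
  rewrite [RHS](bigD1 j)//= eqxx; congr (_ + _).
  rewrite raddf_sum/=; apply: eq_bigr => i /negbTE ->.
  by rewrite expr0 alg_polyC.
rewrite -multinomial_theorem [RHS]big_mkcond; apply: eq_bigr => x _.
rewrite /multinomial_pmf; case: ifP => _; last by rewrite scale0r.
have -> : \prod_i (q i *: 'X^(i == j)) ^+ x i =
    (\prod_i q i ^+ x i) *: 'X^(x j) :> {poly R}.
  under eq_bigr do rewrite exprZn -exprM.
  rewrite scaler_prod prodrXr; congr (_ *: 'X^_).
  by rewrite (bigD1 j)//= eqxx mul1n big1 ?addn0// => i /negbTE ->.
by rewrite scalerA.
Qed.

Lemma expectation_exp j z :
  expectation (fun x => z ^+ x j) = (1 - q j + q j * z) ^+ n.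
Proof.
transitivity (count_pgf j).[z]; last by rewrite count_pgfE !hornerE.
by rewrite horner_sum; apply: eq_bigr => x _; rewrite !hornerE.
Qed.

Lemma expectationD f g :
  expectation (fun x => f x + g x) = expectation f + expectation g.
Proof. by rewrite -big_split; apply: eq_bigr => x _; rewrite mulrDr. Qed.

Lemma expectationZ c f : expectation (fun x => c * f x) = c * expectation f.
Proof. by rewrite mulr_sumr; apply: eq_bigr => x _; rewrite mulrCA. Qed.

(** The mean and the second factorial moment are the first two derivatives of
    the generating function at 1. *)
Lemma expectation_variance j :
  expectation (fun x => ((x j)%:R - n%:R * q j) ^+ 2) =
  n%:R * (q j * (1 - q j)).
Proof.
have E0 : expectation (fun=> 1) = 1.
  have := expectation_exp j 1; rewrite mulr1 subrK expr1n => {2}<-.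
  by apply: eq_bigr => x _; rewrite expr1n.
have E1 : expectation (fun x => (x j)%:R) = n%:R * q j.
  transitivity (count_pgf j)^`().[1].
    rewrite raddf_sum horner_sum; apply: eq_bigr => x _.
    by rewrite /= derivZ derivXn hornerZ hornerMn hornerXn expr1n.
  rewrite count_pgfE deriv_exp !derivE alg_polyC hornerMn !hornerE.
  by rewrite subrK expr1n mulr1 mulr_natl.
have E2 : expectation (fun x => (x j)%:R * ((x j)%:R - 1)) =
    n%:R * (n%:R - 1) * q j ^+ 2.
  transitivity (count_pgf j)^`()^`().[1].
    rewrite !raddf_sum horner_sum; apply: eq_bigr => x _.
    rewrite /= derivZ derivXn derivZ derivMn derivXn hornerZ !hornerMn.
    rewrite hornerXn expr1n; case: (nat_of_ord (x j)) => [|k].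
      by rewrite mulr0n mul0r.
    by rewrite -natr1 addrK /= -(mulr_natr _ k.+1) -natr1 [_ * k%:R]mulrC.
  rewrite count_pgfE !deriv_exp !derivE deriv_exp !derivE.
  rewrite scaler0 add0r mul0r !add0r alg_polyC hornerMn hornerM hornerMn.
  rewrite hornerM horner_exp hornerD hornerZ !hornerC hornerX mulr1 subrK.
  rewrite expr1n mulr1 -mulr_natr -[_ *+ n.-1]mulr_natr.
  case: (n) => [|m]; first by rewrite mulr0 mul0r mul0r.
  by rewrite -[m.+1%:R]natr1 /= addrK; ring.
transitivity (expectation (fun x => (x j)%:R * ((x j)%:R - 1)
   + ((1 - 2 * n%:R * q j) * (x j)%:R + (n%:R * q j) ^+ 2 * 1))).
  by apply: eq_bigr => x _; congr (_ * _) => /=; ring.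
by rewrite !expectationD !expectationZ E0 E1 E2; ring.
Qed.

(** Markov's inequality, in the form used by both tail bounds. *)
Lemma prob_le_expectation A f : (forall x, 0 <= f x) ->
  (forall x, A x -> 1 <= f x) -> multinomial_prob n q A <= expectation f.
Proof.
move=> f0 f1; rewrite /multinomial_prob big_mkcond; apply: ler_sum => x _.
case: ifP => [/f1 f1x|_]; first by rewrite ler_peMr ?pmf_ge0.
by rewrite mulr_ge0 ?pmf_ge0.
Qed.

Lemma prob_le_sum A (I : finType) (P : pred I) (B : I -> pred ('I_p -> nat)) :
  (forall x, A x -> exists2 i, P i & B i x) ->
  multinomial_prob n q A <= \sum_(i | P i) multinomial_prob n q (B i).
Proof.
move=> AB; under [leRHS]eq_bigr do rewrite /multinomial_prob big_mkcond.
rewrite exchange_big /= [leLHS]big_mkcond; apply: ler_sum => x _.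
have ge0 i : 0 <= (if B i (fun j => x j : nat) then
    multinomial_pmf n q (fun j => x j : nat) else 0).
  by case: ifP => // _; apply: pmf_ge0.
case: ifP => [/AB[i Pi Bi]|_]; last by apply: sumr_ge0.
by rewrite (bigD1 i)//= Bi lerDl sumr_ge0.
Qed.

Lemma prob_sub A B : (forall x, A x -> B x) ->
  multinomial_prob n q A <= multinomial_prob n q B.
Proof.
move=> AB; have := @prob_le_sum A unit predT (fun=> B).
rewrite big_const card_unit /= addr0; apply => x /AB; by exists tt.
Qed.

Lemma prob_or A B : multinomial_prob n q (fun x => A x || B x) <=
  multinomial_prob n q A + multinomial_prob n q B.
Proof.
have := @prob_le_sum (fun x => A x || B x) bool predT
  (fun b => if b then A else B).
rewrite big_bool; apply => x /orP[]; by [exists true|exists false].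
Qed.

(** The event A need only force the deviation: it may constrain other
    coordinates as well. *)
Lemma chebyshev j s A : 0 < s ->
  (forall x, A x -> s <= `|(x j)%:R - n%:R * q j|) ->
  multinomial_prob n q A <= n%:R * (q j * (1 - q j)) / s ^+ 2.
Proof.
move=> s0 As; rewrite -expectation_variance mulrC -expectationZ.
apply: prob_le_expectation => x; first by rewrite mulr_ge0 ?invr_ge0 ?sqr_ge0.
move=> /As sx; rewrite [_ * _ ^+ 2]mulrC ler_pdivlMr ?exprn_gt0// mul1r.
by rewrite -[leRHS]real_normK ?num_real// lerXn2r// nnegrE// ltW.
Qed.

End Multinomial.

(** * The Bennett rate function and its inverse *)

Section RateFunction.
Variable R : realType.
Implicit Types x y a b M : R.

(** Convexity of h, stated with its tangents: h' = ln (1 + _).  After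
    simplification it is ln t <= t - 1 at t = (1 + x) / (1 + y).  The growth
    properties of h below are read off these tangents. *)
Lemma h_tangent x y : -1 < x -> -1 < y -> h x + ln (1 + x) * (y - x) <= h y.
Proof.
move=> x1 y1; have px : 0 < 1 + x by lra. have py : 0 < 1 + y by lra.
rewrite /h !gt_eqF//.
pose t := (1 + x) / (1 + y).
have yt : (1 + y) * t = 1 + x by rewrite /t mulrC divfK// gt_eqF.
have : ln t <= t - 1.
  have := @le_ln1Dx R (t - 1); rewrite [1 + (_ - 1)]addrC subrK; apply.
  by rewrite ltrBDl subrr divr_gt0.
by rewrite ln_div// -(ler_pM2l py); lra.
Qed.

Lemma h_0 : h 0 = 0 :> R.
Proof. by rewrite /h eq_sym oppr_eq0 oner_eq0 addr0 ln1 mulr0 subrr. Qed.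

(** The tangent at x lies below h at 0, where h vanishes, and below h at
    M x. *)
Lemma h_scale M x : 1 <= M -> 0 <= x -> M * h x <= h (M * x).
Proof.
move=> M1 x0; have x1 : -1 < x by lra.
have := h_tangent x1 (_ : -1 < 0); rewrite h_0 sub0r => /(_ ltac:(lra)) hx.
have := @h_tangent x (M * x) x1; rewrite (lt_le_trans _ (mulr_ge0 _ x0)); [|lra..].
by move=> /(_ isT); nra.
Qed.

Lemma h_lt x y : 0 <= x -> x < y -> h x < h y.
Proof.
(* The tangent at x may be horizontal (x = 0); the one at the midpoint is not. *)
move=> x0 xy; pose z := (x + y) / 2.
have : h x + ln (1 + x) * (z - x) <= h z by apply: h_tangent; rewrite /z; lra.
have : h z + ln (1 + z) * (y - z) <= h y by apply: h_tangent; rewrite /z; lra.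
have lx : 0 <= ln (1 + x) by apply: ln_ge0; lra.
have lz : 0 < ln (1 + z) by apply: ln_gt0; rewrite /z; lra.
have : 0 < ln (1 + z) * (y - z) by apply: mulr_gt0 => //; rewrite /z; lra.
have : 0 <= ln (1 + x) * (z - x) by apply: mulr_ge0 => //; rewrite /z; lra.
lra.
Qed.

Lemma continuous_h x : 0 <= x -> {for x, continuous (@h R)}.
Proof.
move=> x0.
have H : {for x, continuous (fun x : R => (1 + x) * ln (1 + x) - x)}.
  have c1 : {for x, continuous (fun x : R => 1 + x)}.
    by apply: cvgD; [exact: cvg_cst|exact: cvg_id].
  apply: cvgB; last exact: cvg_id.
  apply: cvgM => //; apply: (continuous_comp c1); apply: continuous_ln; lra.
change (h y @[y --> x] --> h x).
have -> : h x = (1 + x) * ln (1 + x) - x by rewrite /h gt_eqF//; lra.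
apply: cvg_trans H; apply: near_eq_cvg.
near=> y; rewrite /h gt_eqF//.
near: y; apply: lt_nbhsr. lra.
Unshelve. all: by end_near. Qed.

Lemma h_surj : set_surj `[0, +oo[ `[0, +oo[ (@h R).
Proof.
move=> a; rewrite /= in_itv /= andbT => a0.
pose b := a + expR 1.
(* The tangent at e - 1 has slope 1, so h exceeds a at a + e. *)
have e1 : 0 <= expR 1 - 1 :> R by rewrite subr_ge0 ltW// expR_gt1.
have hb : a <= h b.
  have := @h_tangent (expR 1 - 1) b ltac:(lra) ltac:(rewrite /b; lra).
  by rewrite /h gt_eqF 1?[1 + (_ - 1)]addrC ?subrK ?expRK /b; lra.
have [|||c] := @IVT R (@h R) 0 b a.
- by rewrite /b; lra.
- apply: continuous_in_subspaceT => x; rewrite inE /= in_itv /= => /andP[x0 _].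
  exact: continuous_h.
- by have hb0 := le_trans a0 hb; rewrite h_0 min_l// max_r// a0.
- by rewrite in_itv /= => /andP[c0 _] hc; exists c => //=; rewrite in_itv/= c0.
Qed.

Lemma hinvK a : 0 <= a -> h (hinv a) = a.
Proof.
move=> a0; apply: (@surjpK _ _ (fun=> 0) _ _ _ h_surj).
by rewrite inE/= in_itv/= a0.
Qed.

Lemma hinv_ge0 a : 0 <= a -> 0 <= hinv a.
Proof.
move=> a0.
suff : `[0, +oo[%classic (hinv a) by rewrite /= in_itv/= andbT.
by apply: (surjpinv_image_sub h_surj); exists a; rewrite //= in_itv/= a0.
Qed.

(** Monotonicity and concavity of h^-1 combined: a larger value would make h
    exceed M a at M h^-1(a), against [h_scale]. *)
Lemma hinv_le_scale M a b : 1 <= M -> 0 <= a -> 0 <= b <= M * a ->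
  hinv b <= M * hinv a.
Proof.
move=> M1 a0 /andP[b0 bMa]; have ia := hinv_ge0 a0.
rewrite leNgt; apply/negP => /(h_lt (mulr_ge0 (le_trans ler01 M1) ia)).
have := h_scale M1 ia; rewrite !hinvK//; lra.
Qed.
End RateFunction.

(** * Tail bounds for one count *)

(** Termwise comparison of the exponential series: from degree 2 on,
    y^k <= y^2 because |y| <= 1. *)
Lemma expR_le_quadratic (R : realType) (y l : R) : `|y| <= 1 -> 0 <= l ->
  expR (l * y) <= 1 + l * y + y ^+ 2 * (expR l - 1 - l).
Proof.
move=> y1 l0.
pose S x := series (exp_coeff (x : R)).
have cvgS x : S x @ \oo --> expR x by exact: is_cvg_series_exp_coeff.
have cvgT : (fun m => 1 + l * y + y ^+ 2 * (S l m - 1 - l)) @ \oo -->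
    1 + l * y + y ^+ 2 * (expR l - 1 - l).
  apply: cvgD; first exact: cvg_cst.
  apply: cvgM; first exact: cvg_cst.
  by do 2!(apply: cvgB; last exact: cvg_cst).
rewrite -(cvg_lim _ (cvgS (l * y)))// -(cvg_lim _ cvgT)//.
apply: ler_lim; [exact: cvgP (cvgS _)|exact: cvgP cvgT|].
near=> m.
have [k ->] : exists k, m = k.+2.
  by exists m.-2; rewrite -!subn1 -subnDA -addn2 subnK//; near: m; exists 2%N.
have split2 x : S x k.+2 = 1 + x + \sum_(i < k) exp_coeff x i.+2.
  rewrite /S /series /= big_mkord !big_ord_recl /exp_coeff/=.
  by rewrite expr0 expr1 fact0 !divr1 addrA.
rewrite !split2 lerD2l [X in y ^+ 2 * X](_ : _ = \sum_(i < k) exp_coeff l i.+2).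
  rewrite mulr_sumr; apply: ler_sum => i _; rewrite /exp_coeff/=.
  rewrite mulrA ler_pM2r ?invr_gt0 ?ltr0n ?fact_gt0//.
  rewrite exprMn mulrC ler_wpM2r ?exprn_ge0//.
  rewrite -addn2 exprD ler_piMl ?sqr_ge0// (le_trans (ler_norm _))// normrX.
  by rewrite exprn_ile1.
ring.
Unshelve. all: by end_near. Qed.

(** A centred Bernoulli variable takes the values - q and 1 - q, so the
    quadratic bound applies to both; its mean is 0 and its variance is
    q (1 - q). *)
Lemma bernoulli_mgf_le (R : realType) (q l : R) : 0 <= q <= 1 -> 0 <= l ->
  (1 - q) * expR (- (l * q)) + q * expR (l * (1 - q)) <=
  expR (q * (1 - q) * (expR l - 1 - l)).
Proof.
move=> /andP[q0 q1] l0.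
have := @expR_le_quadratic R (- q) l; rewrite normrN ger0_norm// mulrN sqrrN.
move=> /(_ q1 l0) /(ler_wpM2l (_ : 0 <= 1 - q)) => /(_ ltac:(lra)) le1.
have := @expR_le_quadratic R (1 - q) l; rewrite ger0_norm ?subr_ge0//.
move=> /(_ ltac:(lra) l0) /(ler_wpM2l q0) le2.
apply: le_trans (expR_ge1Dx _); apply: le_trans (lerD le1 le2) _.
by rewrite le_eqVlt; apply/orP; left; apply/eqP; ring.
Qed.

Section Bennett.
Variables (R : realType) (n p : nat) (q : 'I_p -> R).
Hypothesis q_simplex : simplex q.
Implicit Type j : 'I_p.

Let q01 j : 0 <= q j <= 1. Proof. by case: q_simplex => /(_ j). Qed.

Lemma mgf_upper j l : 0 <= l ->
  expectation n q (fun x => expR (l * ((x j)%:R - n%:R * q j))) <=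
  expR (n%:R * (q j * (1 - q j)) * (expR l - 1 - l)).
Proof.
move=> l0.
have -> : expectation n q (fun x => expR (l * ((x j)%:R - n%:R * q j))) =
    ((1 - q j) * expR (- (l * q j)) + q j * expR (l * (1 - q j))) ^+ n.
  transitivity (expR (- (l * q j)) ^+ n * (1 - q j + q j * expR l) ^+ n).
    rewrite -expectation_exp// -expectationZ; apply: eq_bigr => x _.
    by rewrite -!expRM_natl -expRD; congr (_ * expR _); ring.
  rewrite -exprMn; congr (_ ^+ _).
  rewrite [l * (1 - _)](_ : _ = - (l * q j) + l); last by ring.
  by rewrite expRD; ring.
rewrite -mulrA expRM_natl lerXn2r ?nnegrE ?expR_ge0//;
  last exact: bernoulli_mgf_le.
have /andP[q0 q1] := q01 j.
by rewrite addr_ge0 ?mulr_ge0 ?expR_ge0 ?subr_ge0.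
Qed.

(** The deviation below the mean is the deviation above the mean of the
    complementary count, hence the Bernoulli bound at 1 - q_j. *)
Lemma mgf_lower j l : 0 <= l ->
  expectation n q (fun x => expR (- l * ((x j)%:R - n%:R * q j))) <=
  expR (n%:R * (q j * (1 - q j)) * (expR l - 1 - l)).
Proof.
move=> l0; have /andP[q0 q1] := q01 j.
have -> : expectation n q (fun x => expR (- l * ((x j)%:R - n%:R * q j))) =
    ((1 - q j) * expR (l * q j) + q j * expR (- (l * (1 - q j)))) ^+ n.
  transitivity (expR (l * q j) ^+ n * (1 - q j + q j * expR (- l)) ^+ n).
    rewrite -expectation_exp// -expectationZ; apply: eq_bigr => x _.
    by rewrite -!expRM_natl -expRD; congr (_ * expR _); ring.
  rewrite -exprMn; congr (_ ^+ _).
  rewrite [- (l * (1 - _))](_ : _ = (l * q j) + (- l)); last by ring.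
  by rewrite expRD; ring.
rewrite -mulrA expRM_natl lerXn2r ?nnegrE ?expR_ge0//.
  by rewrite addr_ge0 ?mulr_ge0 ?expR_ge0 ?subr_ge0.
have := @bernoulli_mgf_le R (1 - q j) l ltac:(lra) l0.
by rewrite subKr [q j * (1 - _)]mulrC [X in X <= _]addrC.
Qed.

(** The exponent V (exp l - 1 - l) - l V t of the Chernoff bound is minimal at
    l = ln (1 + t), where it equals - V h(t). *)
Lemma bennett j t : 0 <= t ->
  multinomial_prob n q
    (fun x => n%:R * (q j * (1 - q j)) * t <= `|(x j)%:R - n%:R * q j|) <=
  2 * expR (- (n%:R * (q j * (1 - q j)) * h t)).
Proof.
move=> t0; set V := n%:R * _; pose l := ln (1 + t).
have l0 : 0 <= l by apply: ln_ge0; lra.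
have el : expR l = 1 + t by rewrite lnK// posrE; lra.
pose D x : R := (x j)%:R - n%:R * q j.
have := @prob_le_expectation R n p q q_simplex (fun x => V * t <= `|D x|)
  (fun x => expR (- (l * (V * t))) * (expR (l * D x) + expR (- l * D x))).
have ge0 x : 0 <= expR (- (l * (V * t))) * (expR (l * D x) + expR (- l * D x)).
  by rewrite mulr_ge0 ?addr_ge0 ?expR_ge0.
move=> /(_ ge0) le_prob; apply: le_trans (le_prob _) _ => [x|].
  move=> /(ler_wpM2l l0) lD; rewrite mulrDr -!expRD.
  have [D0|D0] := leP 0 (D x); rewrite ?(ger0_norm D0) ?(ltr0_norm D0) in lD.
    have : 1 <= expR (- (l * (V * t)) + l * D x) 
      by rewrite -[leLHS]expR0 ler_expR; lra.
    by have := expR_ge0 (- (l * (V * t)) + - l * D x); lra.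
  have : 1 <= expR (- (l * (V * t)) + - l * D x) by rewrite -[leLHS]expR0 ler_expR; lra.
  by have := expR_ge0 (- (l * (V * t)) + l * D x); lra.
rewrite expectationZ expectationD.
have -> : 2 * expR (- (V * h t)) =
    expR (- (l * (V * t))) * (2 * expR (V * (expR l - 1 - l))).
  rewrite mulrCA -expRD el /h gt_eqF; last lra.
  by congr (_ * expR _); rewrite /l; ring.
rewrite ler_wpM2l ?expR_ge0//; have := mgf_upper j l0; have := mgf_lower j l0.
rewrite -/V; lra.
Qed.

(** The threshold is tailored so that Bennett's exponent equals a.  The
    inequality in the event is strict because a degenerate coordinate has
    threshold 0 and deviation 0. *)
Lemma prob_gt_vhinv j a : (0 < n)%N -> 0 <= a ->
  multinomial_prob n q
    (fun x => n%:R * vhinv n a (q j * (1 - q j)) < `|(x j)%:R - n%:R * q j|) <=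
  2 * expR (- a).
Proof.
move=> n0 a0; have /andP[q0 q1] := q01 j; rewrite /vhinv.
have [v0|v_neq0] := eqVneq (q j * (1 - q j)) 0.
  (* With variance 0, every outcome off the mean has probability 0. *)
  rewrite mulr0 /multinomial_prob big1; first by rewrite mulr_ge0 ?expR_ge0.
  move=> x; rewrite normr_gt0 => Dx.
  have := expectation_variance n q_simplex j; rewrite v0 mulr0.
  move=> /psumr_eq0P/(_ x isT)/eqP; rewrite mulf_eq0 expf_eq0/= (negPf Dx) orbF.
  move=> H; apply/eqP/H => y _.
  by rewrite mulr_ge0 ?sqr_ge0 ?pmf_ge0.
have v0 : 0 < q j * (1 - q j) by rewrite lt0r v_neq0 mulr_ge0 ?subr_ge0.
have V0 : 0 < n%:R * (q j * (1 - q j)) by rewrite mulr_gt0 ?ltr0n.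
have b0 : 0 <= a / (n%:R * (q j * (1 - q j))) by apply: divr_ge0 => //; apply: ltW.
apply: le_trans (_ : 2 * expR (- (n%:R * (q j * (1 - q j)) *
  h (hinv (a / (n%:R * (q j * (1 - q j))))))) <= _); last first.
  by rewrite hinvK// [_ * (a / _)]mulrC divfK ?gt_eqF.
apply: le_trans (bennett j (hinv_ge0 b0)); apply: prob_sub => // x.
by rewrite mulrA => /ltW.
Qed.
End Bennett.

(** * Variances and thresholds *)

(** Telescoping: 1/(i+1)^2 <= 1/i - 1/(i+1). *)
Lemma sum_inv_sqr_le2 (R : realFieldType) p :
  \sum_(j < p | (0 < j)%N) (j%:R ^+ 2)^-1 <= 2 :> R.
Proof.
case: p => [|p]; first by rewrite big_ord0.
rewrite big_mkcond big_ord_recl /= add0r.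
(* At p = 0 the bound reads 2, by 0^-1 = 0; the telescoping starts at p = 1. *)
suff : \sum_(i < p) ((i.+1)%:R ^+ 2)^-1 <= 2 - p%:R^-1 :> R.
  by move=> H; apply: le_trans H _; rewrite gerBl invr_ge0.
elim: p => [|[_|p IH]]; first by rewrite big_ord0 invr0 subr0.
  by rewrite big_ord1 mulr1n expr1n invr1; lra.
rewrite big_ord_recr /=; apply: le_trans (lerD IH (lexx _)) _.
have p0 : 0 < p.+1%:R :> R by rewrite ltr0n.
rewrite -[p.+2%:R]natr1; set x := p.+1%:R in p0 *.
suff : x^-1 - (x + 1)^-1 - ((x + 1) ^+ 2)^-1 >= 0.
  by move: (x^-1) ((x + 1)^-1) (_ ^- 2) => u v w; lra.
rewrite [leRHS](_ : _ = (x * (x + 1) ^+ 2)^-1).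
  by rewrite invr_ge0 mulr_ge0 ?sqr_ge0 ?ltW.
by field; apply/andP; split; apply: lt0r_neq0; lra.
Qed.

Lemma vhinv_le_scale (R : realType) n (M a b v : R) :
  0 <= v -> 1 <= M -> 0 <= a -> 0 <= b <= M * a ->
  vhinv n b v <= M * vhinv n a v.
Proof.
move=> v0 M1 a0 /andP[b0 bMa]; rewrite /vhinv.
case: ifP => _; first by rewrite mulr0.
rewrite mulrCA ler_wpM2l// hinv_le_scale//.
  by rewrite divr_ge0 ?mulr_ge0.
by rewrite divr_ge0 ?mulr_ge0// mulrA ler_wpM2r ?invr_ge0 ?mulr_ge0.
Qed.

(** The derivative of x |-> x (1 - x) stays in [-1, 1] on [0, 1]. *)
Lemma variance_lipschitz (R : realFieldType) (a b : R) :
  0 <= a <= 1 -> 0 <= b <= 1 -> a * (1 - a) <= b * (1 - b) + `|a - b|.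
Proof.
move=> /andP[a0 a1] /andP[b0 b1].
have [ab|ba] := leP 0 (a - b); [rewrite ger0_norm//|rewrite ltr0_norm//].
all: rewrite -subr_ge0.
  rewrite [leRHS](_ : _ = (a - b) * (a + b)); last by ring.
  by rewrite mulr_ge0//; lra.
rewrite [leRHS](_ : _ = (b - a) * (2 - a - b)); last by ring.
by rewrite mulr_ge0//; lra.
Qed.

(** * The two errors of the test *)

Section SortedNull.
Variables (R : realType) (n p : nat) (hp : (2 <= p)%N) (q0 : 'I_p -> R).
Hypotheses (n_gt0 : (1 <= n)%N) (q0_simplex : simplex q0).
Hypothesis q0_sorted : forall i j : 'I_p, (i <= j)%N -> q0 j <= q0 i.
Let first := ord_first hp.
Let n0 : 0 < n%:R :> R. Proof. by rewrite ltr0n. Qed.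
Let q001 j : 0 <= q0 j <= 1. Proof. by case: q0_simplex => /(_ j). Qed.
Let v_ge0 j : 0 <= q0 j * (1 - q0 j).
Proof. by have /andP[? ?] := q001 j; rewrite mulr_ge0 ?subr_ge0. Qed.

Lemma qmax_first : qmax q0 = q0 first.
Proof.
apply/eqP; rewrite eq_le le_bigmax andbT; apply/bigmax_leP; split.
  by have /andP[] := q001 first.
by move=> j _; apply: q0_sorted.
Qed.

(** x |-> x (1 - x) takes its value at q0(0) also at 1 - q0(0), and it
    increases up to the smaller of these two points; for j > 0, q0(j) lies
    below both. *)
Lemma variance_le_first j : q0 j * (1 - q0 j) <= q0 first * (1 - q0 first).
Proof.
have [->//|j_neq] := eqVneq j first.
have le1 : q0 first + q0 j <= 1.
  case: q0_simplex => _ <-; rewrite (bigD1 first)//= lerD2l (bigD1 j)//=.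
  by rewrite lerDl sumr_ge0// => i _; case/andP: (q001 i).
have le2 : q0 j <= q0 first by apply: q0_sorted.
rewrite -subr_ge0 [leRHS](_ : _ = (q0 first - q0 j) * (1 - q0 first - q0 j)).
  by rewrite mulr_ge0//; lra.
ring.
Qed.

(** Chebyshev's inequality for the first coordinate, and for the others a union
    bound, each against its own threshold, which the maximal one dominates. *)
Lemma type_I_error_le (K1 K2 : R) : 0 < K1 -> 1 <= K2 ->
  multinomial_prob n q0 (phi n hp K1 K2 q0) <= (K1 ^+ 2)^-1 + 4 / K2.
Proof.
move=> K10 K21; apply: le_trans (prob_or _ _ _ _) _ => //; apply: lerD.
  set v := n%:R * q0 first * (1 - q0 first).
  have v0 : 0 <= v by rewrite /v -mulrA mulr_ge0// ltW.
  have s0 := sqrtr_ge0 v.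
  have K1s : 0 < K1 * (1 + Num.sqrt v) by rewrite mulr_gt0//; lra.
  apply: le_trans (chebyshev (j := first) q0_simplex K1s _) _ => //.
  rewrite mulrA -/v exprMn invfM mulrCA ler_piMr ?invr_ge0 ?sqr_ge0//.
  have s1 : 0 < 1 + Num.sqrt v by lra.
  rewrite ler_pdivrMr ?exprn_gt0// mul1r -[leLHS]sqr_sqrtr//.
  by rewrite lerXn2r ?nnegrE// ?ltW// ltrDr.
pose a (j : 'I_p) := ln (K2 * (j : nat)%:R ^+ 2).
pose t j := n%:R * vhinv n (a j) (q0 j * (1 - q0 j)).
apply: le_trans (@prob_le_sum R n p q0 q0_simplex _ 'I_p
  (fun j => (0 < j)%N) (fun j x => t j < `|(x j)%:R - n%:R * q0 j|) _) _.
  move=> x; rewrite /phi2 -/(t _); set T := \big[_/_]_(_ < _ | _) _ => T_lt.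
  have [/existsP[j /andP[j0 Tj]]|] :=
    boolP [exists j : 'I_p, (0 < j)%N && (T < `|(x j)%:R - n%:R * q0 j|)].
    by exists j => //; apply: le_lt_trans Tj; apply: (le_bigmax_cond _ t).
  rewrite negb_exists => /forallP no; move: T_lt; rewrite ltNge => /negP[].
  apply/bigmax_leP; split; first exact: bigmax_ge_id.
  by move=> j j0; have := no j; rewrite j0 -leNgt.
have -> : 4 / K2 = 2 / K2 * 2 by ring.
apply: le_trans (_ : \sum_(j < p | (0 < j)%N) 2 / K2 * (j%:R ^+ 2)^-1 <= _);
  last by rewrite -mulr_sumr ler_wpM2l ?sum_inv_sqr_le2// divr_ge0//; lra.
apply: ler_sum => j j0.
have Kj : 1 <= K2 * (j : nat)%:R ^+ 2.
  by apply: mulr_ege1 => //; apply: exprn_ege1; rewrite (ler_nat _ 1).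
apply: le_trans (prob_gt_vhinv q0_simplex j n_gt0 (ln_ge0 Kj)) _.
by rewrite expRN lnK ?posrE ?(lt_le_trans ltr01)// invfM mulrA.
Qed.

(** Missing a shift d of coordinate j: if the count stays within n d / 2 of its
    null mean, it is at least n d / 2 away from its true mean.  The true
    variance is at most n (v + d), for v = q0(0) (1 - q0(0)), and since
    v / n <= r^2 and 1 / n <= r with r <= d / C, Chebyshev's ratio is
    of order 1 / C. *)
Lemma prob_far_le (q : 'I_p -> R) (j : 'I_p) (C r : R)
    (A : pred ('I_p -> nat)) :
  simplex q -> 1 <= C -> n%:R^-1 <= r ->
  Num.sqrt (q0 first * (1 - q0 first) / n%:R) <= r ->
  C * r <= `|q j - q0 j| ->
  (forall x, A x -> `|(x j)%:R - n%:R * q0 j| <= n%:R * (`|q j - q0 j| / 2)) ->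
  multinomial_prob n q A <= 8 / C.
Proof.
move=> q_simplex C1 nr vr; set d := `|q j - q0 j| => Crd A_near.
have r0 : 0 < r by apply: lt_le_trans nr; rewrite invr_gt0.
have C0 : 0 < C by lra.
have d0 : 0 < d by apply: lt_le_trans Crd; apply: mulr_gt0.
have nd0 : 0 < n%:R * (d / 2) by apply: mulr_gt0 => //; lra.
have q01 : 0 <= q j <= 1 by case: q_simplex.
apply: le_trans (chebyshev (j := j) q_simplex nd0 _) _ => [x /A_near le_x|].
  have : n%:R * d = `|n%:R * q j - n%:R * q0 j|.
    by rewrite -mulrBr normrM [`|n%:R|]ger0_norm// ltW.
  have := ler_distD (x j)%:R (n%:R * q j) (n%:R * q0 j).
  rewrite [`|n%:R * q j - (x j)%:R|]distrC; lra.
have rC : r <= d / C by rewrite ler_pdivlMr// mulrC.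
have var_le : q j * (1 - q j) / n%:R <= 2 * d ^+ 2 / C.
  have le1 : q j * (1 - q j) <= q0 first * (1 - q0 first) + d.
    apply: le_trans (variance_lipschitz q01 (q001 j)) _.
    by rewrite lerD2r variance_le_first.
  have v0 : 0 <= q0 first * (1 - q0 first) / n%:R by rewrite divr_ge0.
  have le2 : q0 first * (1 - q0 first) / n%:R <= d ^+ 2 / C.
    rewrite -[leLHS]sqr_sqrtr//; apply: le_trans (_ : r ^+ 2 <= _).
      by rewrite lerXn2r ?nnegrE ?sqrtr_ge0// ltW.
    have rd : r <= d.
      by apply: le_trans rC _; rewrite ler_pdivrMr// ler_peMr// ltW.
    by rewrite expr2 expr2 -mulrA ler_pM// ltW.
  have le3 : d / n%:R <= d ^+ 2 / C.
    by rewrite expr2 -mulrA ler_wpM2l ?(ltW d0)// (le_trans nr).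
  apply: le_trans (_ : (q0 first * (1 - q0 first) + d) / n%:R <= _).
    by rewrite ler_wpM2r// invr_ge0 ltW.
  rewrite mulrDl; lra.
have -> : n%:R * (q j * (1 - q j)) / (n%:R * (d / 2)) ^+ 2 =
    q j * (1 - q j) / n%:R * (4 / d ^+ 2) by field; rewrite !gt_eqF.
have -> : 8 / C = 2 * d ^+ 2 / C * (4 / d ^+ 2) by field; rewrite !gt_eqF.
by rewrite ler_wpM2r// divr_ge0 ?sqr_ge0.
Qed.

(** Some coordinate j is shifted by at least C eps.  It is left to see that
    acceptance keeps X_j within n c eps of its null mean for some c <= C / 2:
    the first test gives c = K1, the second one c = 2 + ln K2. *)
Lemma type_II_error_le (K1 K2 C : R) (q : 'I_p -> R) : 0 < K1 -> 1 <= K2 ->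
  1 <= C -> 2 * K1 <= C -> 2 * (2 + ln K2) <= C ->
  alternatives q0 (C * eps_rate n q0) q ->
  multinomial_prob n q (fun x => ~~ phi n hp K1 K2 q0 x) <= 8 / C.
Proof.
move=> K10 K21 C1 K1C K2C [q_simplex].
set rmax := \big[Num.max/0]_(j < p | (0 < j)%N)
    vhinv n (ln (expR 1 * (j : nat)%:R)) (q0 j * (1 - q0 j)).
have rmax0 : 0 <= rmax by exact: bigmax_ge_id.
have epsE : eps_rate n q0 =
    n%:R^-1 + Num.sqrt (q0 first * (1 - q0 first) / n%:R) + rmax.
  by rewrite /eps_rate qmax_first.
set r := eps_rate n q0 in epsE *.
have n_inv0 : 0 < n%:R^-1 :> R by rewrite invr_gt0.
have s0 := sqrtr_ge0 (q0 first * (1 - q0 first) / n%:R).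
have r0 : 0 < r by lra.
have Cr0 : 0 < C * r by apply: mulr_gt0 => //; lra.
move=> /bigmax_geP[|[j _ Crj]]; first by lra.
have lK2 : 0 <= ln K2 by apply: ln_ge0.
apply: (prob_far_le (j := j) (r := r)) => //; [lra|lra|].
move=> x; rewrite negb_or => /andP[nphi1 nphi2].
set d := `|q j - q0 j|.
suff [c cC] : exists2 c, 2 * c <= C & `|(x j)%:R - n%:R * q0 j| <= n%:R * (c * r).
  move=> /le_trans; apply; rewrite ler_wpM2l ?(ltW n0)// ler_pdivlMr//.
  apply: le_trans Crj; rewrite mulrAC ler_wpM2r ?(ltW r0)//; lra.
have [->|j_neq] := eqVneq j first.
  exists K1 => //; move: nphi1; rewrite /phi1 -/first -ltNge => /ltW /le_trans; apply.
  rewrite mulrCA ler_wpM2l ?(ltW K10)//.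
  have -> : Num.sqrt (n%:R * q0 first * (1 - q0 first)) =
      n%:R * Num.sqrt (q0 first * (1 - q0 first) / n%:R).
    rewrite -{2}[n%:R]ger0_norm ?ltW// -sqrtr_sqr -sqrtrM ?sqr_ge0//.
    by congr Num.sqrt; field; rewrite gt_eqF.
  rewrite epsE !mulrDr divff ?gt_eqF// lerDl.
  by rewrite mulr_ge0 ?(ltW n0).
have j0 : (0 < j)%N.
  by rewrite lt0n; apply: contra j_neq => /eqP j0; apply/eqP/val_inj.
exists (2 + ln K2) => //; move: nphi2; rewrite /phi2 -leNgt => le_max.
apply: le_trans (le_trans _ le_max) _.
  exact: (le_bigmax_cond _ (fun j => `|(x j)%:R - n%:R * q0 j|)).
have M0 : 0 <= 2 + ln K2 by lra.
apply/bigmax_leP; split=> [|i i0].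
  by rewrite !mulr_ge0// ltW.
rewrite ler_wpM2l ?(ltW n0)//; apply: le_trans (_ : (2 + ln K2) * rmax <= _); last first.
  by rewrite ler_wpM2l// epsE; lra.
have i1 : 1 <= (i : nat)%:R :> R by rewrite ler1n.
have li : 0 <= ln (i : nat)%:R :> R by apply: ln_ge0.
have aE : ln (expR 1 * (i : nat)%:R) = 1 + ln (i : nat)%:R :> R.
  by rewrite lnM ?posrE ?expR_gt0 ?(lt_le_trans ltr01)// expRK.
have bE : ln (K2 * (i : nat)%:R ^+ 2) = ln K2 + 2 * ln (i : nat)%:R :> R.
  rewrite lnM ?posrE ?exprn_gt0 ?(lt_le_trans ltr01)//.
  by rewrite lnXn ?(lt_le_trans ltr01)// mulr_natl.
apply: le_trans (_ : (2 + ln K2) *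
  vhinv n (ln (expR 1 * (i : nat)%:R)) (q0 i * (1 - q0 i)) <= _); last first.
  rewrite ler_wpM2l//.
  exact: (le_bigmax_cond _ (fun j : 'I_p =>
    vhinv n (ln (expR 1 * (j : nat)%:R)) (q0 j * (1 - q0 j)))).
apply: vhinv_le_scale => //; rewrite ?aE ?bE; [lra|lra|].
have : 0 <= ln K2 * ln (i : nat)%:R by apply: mulr_ge0.
by move=> ?; apply/andP; split; lra.
Qed.
End SortedNull.

Lemma expR1_le4 (R : realType) : expR 1 <= 4 :> R.
Proof.
(* exp (1/2) <= 2, since exp (- 1/2) >= 1/2. *)
have := expR_ge1Dx (- (1 / 2) : R); rewrite expRN => le1.
have e0 := expR_gt0 (1 / 2 : R).
have e2 : expR (1 / 2) <= 2 :> R.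
  rewrite -[leLHS]invrK -[leRHS]invrK lef_pV2 ?posrE ?invr_gt0//; lra.
have -> : 1 = 1 / 2 + 1 / 2 :> R by lra.
by rewrite expRD; nra.
Qed.

Theorem theorem4 (R : realType) (eta : R) (heta : 0 < eta < 1) :
  exists K1 C K2 : R,
    [/\ 0 < K1, 0 < C, expR 1 <= K2 &
      forall (n p : nat) (hn : (1 <= n)%N) (hp : (2 <= p)%N) (q0 : 'I_p -> R),
        simplex q0 ->
        (forall i j : 'I_p, (i <= j)%N -> q0 j <= q0 i) ->
        multinomial_prob n q0 (fun x => phi n hp K1 K2 q0 x)
        + sup [set multinomial_prob n q (fun x => ~~ phi n hp K1 K2 q0 x)
              | q in alternatives q0 (C * eps_rate n q0)]
        <= eta].
Proof.
have /andP[eta0 eta1] := heta.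
(* The false alarms cost eta^2 / 4 + eta / 4, the missed alternatives eta / 2. *)
pose i := eta^-1.
have i1 : 1 < i by rewrite invf_gt1.
have e4 := expR1_le4 R.
pose K1 := 2 * i; pose K2 := 16 * i; pose C := 16 * i + 2 * (2 + ln K2).
have K2_ge1 : 1 <= K2 by rewrite /K2; lra.
have lK2 : 0 <= ln K2 by apply: ln_ge0.
have K1_gt0 : 0 < K1 by rewrite /K1; lra.
have C_ge : 16 * i <= C by rewrite /C; lra.
exists K1, C, K2; split; [by []|by rewrite /C; lra|by rewrite /K2; lra|].
move=> n p hn hp q0 q0_simplex q0_sorted.
have := type_I_error_le hp hn q0_simplex K1_gt0 K2_ge1.
have -> : (K1 ^+ 2)^-1 = eta ^+ 2 / 4 by rewrite /K1 /i; field; lra.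
have -> : 4 / K2 = eta / 4 by rewrite /K2 /i; field; lra.
have eta2 : eta ^+ 2 <= eta by rewrite expr2 ler_piMl ?(ltW eta0) ?(ltW eta1).
suff : sup [set multinomial_prob n q (fun x => ~~ phi n hp K1 K2 q0 x)
              | q in alternatives q0 (C * eps_rate n q0)] <= eta / 2 by lra.
set S := [set _ | _ in _].
have [->|S_neq0] := eqVneq S set0; first by rewrite sup0; lra.
apply: ge_sup; first exact/set0P.
move=> _ [q alt_q <-].
apply: le_trans (type_II_error_le hp hn q0_simplex q0_sorted K1_gt0 K2_ge1 _ _ _ alt_q) _;
  [by lra|by rewrite /C /K1; lra|by rewrite /C; lra|].
rewrite ler_pdivrMr; last lra.
apply: le_trans (_ : eta / 2 * (16 * i) <= _); last by rewrite ler_wpM2l//; lra.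
by rewrite /i [leRHS](_ : _ = 8)//; field; lra.
Qed.
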